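(* Let $\Sigma=(X,\mathcal{U},\phi)$ be a forward complete control system. The following statements are equivalent: (i) $\Sigma$ is ISS. (ii) $\Sigma$ is UAG, CEP, and BRS. (iii) $\Sigma$ is ULIM, ULS, and BRS. (iv) $\Sigma$ is ULIM and UGS.
   Context: A forward complete control system $\Sigma=(X,\mathcal{U},\phi)$ consists of: a normed linear space $(X,\|\cdot\|_X)$; a set $U$ of input values, a nonempty subset of a normed linear space; a set $\mathcal{U}\subset\{f:\mathbb{R}_+\to U\}$ of inputs endowed with a norm $\|\cdot\|_{\mathcal{U}}$, containing the zero input, such that for all $u\in\mathcal{U}$, $\tau\ge 0$ the shift $u(\cdot+\tau)$ lies in $\mathcal{U}$ with $\|u(\cdot+\tau)\|_{\mathcal{U}}\le\|u\|_{\mathcal{U}}$, and such that for all $u_1,u_2\in\mathcal{U}$, $t>0$ the concatenation ($u(\tau)=u_1(\tau)$ for $\tau\in[0,t]$, $u(\tau)=u_2(\tau-t)$ for $\tau>t$) lies in $\mathcal{U}$; and a map $\phi:\mathbb{R}_+\times X\times\mathcal{U}\to X$, defined everywhere, such that: $\phi(0,x,u)=x$; (causality) if $u(s)=\tilde u(s)$ for all $s\in[0,t]$ then $\phi(t,x,u)=\phi(t,x,\tilde u)$; $t\mapsto\phi(t,x,u)$ is continuous; (cocycle) $\phi(h,\phi(t,x,u),u(t+\cdot))=\phi(t+h,x,u)$ for all $t,h\ge0$. $\mathcal{K}$: continuous strictly increasing $\gamma:\mathbb{R}_+\to\mathbb{R}_+$ with $\gamma(0)=0$; $\mathcal{K}_\infty$: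 unbounded elements of $\mathcal{K}$; $\mathcal{L}$: continuous strictly decreasing $\gamma:\mathbb{R}_+\to\mathbb{R}_+$ with limit $0$ at $\infty$; $\mathcal{KL}$: continuous $\beta:\mathbb{R}_+^2\to\mathbb{R}_+$ with $\beta(\cdot,t)\in\mathcal{K}$ for all $t\ge0$ and $\beta(r,\cdot)\in\mathcal{L}$ for all $r>0$. $B_r$, $B_{r,\mathcal{U}}$ are the open balls of radius $r$ around $0$ in $X$, $\mathcal{U}$; bars denote closure. - ISS: there are $\beta\in\mathcal{KL}$, $\gamma\in\mathcal{K}$ with $\|\phi(t,x,u)\|_X\le\beta(\|x\|_X,t)+\gamma(\|u\|_{\mathcal{U}})$ for all $x\in X$, $u\in\mathcal{U}$, $t\ge0$. - UAG: there is $\gamma\in\mathcal{K}_\infty\cup\{0\}$ such that for all $\varepsilon,r>0$ there is $\tau=\tau(\varepsilon,r)<\infty$ such that $\|\phi(t,x,u)\|_X\le\varepsilon+\gamma(\|u\|_{\mathcal{U}})$ for all $u\in\mathcal{U}$, $x\in B_r$, $t\ge\tau$. - CEP: $\phi(t,0,0)=0$ for all $t\ge0$, and for every $\varepsilon>0$, $h>0$ there is $\delta>0$ such that $t\in[0,h]$, $\|x\|_X\le\delta$, $\|u\|_{\mathcal{U}}\le\delta$ imply $\|\phi(t,x,u)\|_X\le\varepsilon$. - BRS: for all $C,\tau>0$, $\sup\{\|\phi(t,x,u)\|_X:\|x\|_X\le C,\|u\|_{\mathcal{U}}\le C,t\in[0,\tau]\}<\infty$. - ULIM: there is $\gamma\in\mathcal{K}\cup\{0\}$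 such that for all $\varepsilon>0$, $r>0$ there is $\tau=\tau(\varepsilon,r)$ such that for all $x$ with $\|x\|_X\le r$ and all $u\in\mathcal{U}$ there is $t\le\tau$ with $\|\phi(t,x,u)\|_X\le\varepsilon+\gamma(\|u\|_{\mathcal{U}})$. - ULS: there are $\sigma\in\mathcal{K}_\infty$, $\gamma\in\mathcal{K}_\infty\cup\{0\}$, $r>0$ with $\|\phi(t,x,u)\|_X\le\sigma(\|x\|_X)+\gamma(\|u\|_{\mathcal{U}})$ for all $x\in\overline{B_r}$, $u\in\overline{B_{r,\mathcal{U}}}$, $t\ge0$. - UGS: there are $\sigma\in\mathcal{K}_\infty$, $\gamma\in\mathcal{K}_\infty\cup\{0\}$ such that the last estimate holds for all $x\in X$, $u\in\mathcal{U}$, $t\ge0$. *)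

(* Defs.v *)
From HB Require Import structures.
From mathcomp Require Import all_boot all_order all_algebra.
From mathcomp Require Import all_classical all_reals all_analysis.

Set Implicit Arguments.
Unset Strict Implicit.
Unset Printing Implicit Defensive.

Import Order.TTheory GRing.Theory Num.Theory.
Import numFieldNormedType.Exports.

Local Open Scope classical_set_scope.
Local Open Scope ring_scope.

(** Comparison functions on R_+ are total functions on R whose values at
    negative arguments are irrelevant. *)
Section comparison_functions.
Variable R : realType.
Implicit Types (gamma : R -> R) (beta : R -> R -> R).

Definition class_K gamma : Prop :=
  [/\ {within `[0, +oo[, continuous gamma},
      (forall r : R, 0 <= r -> 0 <= gamma r),
      (forall r s : R, 0 <= r -> r < s -> gamma r < gamma s)
    & gamma 0 = 0].

Definition class_Kinf gamma : Prop :=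
  class_K gamma /\ (forall M : R, exists2 r, 0 <= r & M < gamma r).

Definition class_L gamma : Prop :=
  [/\ {within `[0, +oo[, continuous gamma},
      (forall t : R, 0 <= t -> 0 <= gamma t),
      (forall s t : R, 0 <= s -> s < t -> gamma t < gamma s)
    & gamma t @[t --> +oo] --> (0 : R)].

Definition class_KL beta : Prop :=
  [/\ {within `[0, +oo[ `*` `[0, +oo[,
         continuous (fun p : R * R => beta p.1 p.2)},
      (forall t : R, 0 <= t -> class_K (fun r => beta r t))
    & (forall r : R, 0 < r -> class_L (beta r))].

Definition zero_gain gamma : Prop := forall r : R, 0 <= r -> gamma r = 0.

End comparison_functions.

Section signals.
Variables (R : realType) (W : normedModType R).
Implicit Types u v : {nonneg R} -> W.

Definition input_shift (tau : {nonneg R}) u : {nonneg R} -> W :=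
  fun s => u (s%:num + tau%:num)%:nng.

(** The absolute value only serves to land in [{nonneg R}]: it is taken of
    the positive number [s - t]. *)
Definition input_concat (t : {nonneg R}) u v : {nonneg R} -> W :=
  fun s => if s%:num <= t%:num then u s else v (`|s%:num - t%:num|)%:nng.

End signals.

Definition linear_subspace (R : realType) (V : lmodType R) (L : set V) : Prop :=
  L 0 /\ (forall (a : R) u v, L u -> L v -> L (a *: u + v)).

Definition norm_on (R : realType) (V : lmodType R) (L : set V) (N : V -> R) :
    Prop :=
  [/\ (forall u, L u -> 0 <= N u),
      (forall u, L u -> N u = 0 -> u = 0),
      (forall (a : R) u, L u -> N (a *: u) = `|a| * N u)
    & (forall u v, L u -> L v -> N (u + v) <= N u + N v)].

(** Forward complete control systems with state space [X] and input values in
    a subset of [W].  The set of inputs need not be a linear space: its norm is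
    the restriction of a norm on some linear space [input_space] of [W]-valued
    functions containing it.  The values of [flow] at functions that are not
    inputs are irrelevant. *)
Record control_system (R : realType) (X W : normedModType R) := ControlSystem {
  input_values : set W ;
  input_space : set ({nonneg R} -> W) ;
  input_norm : ({nonneg R} -> W) -> R ;
  inputs : set ({nonneg R} -> W) ;
  flow : {nonneg R} -> X -> ({nonneg R} -> W) -> X ;
  input_values_nonempty : input_values !=set0 ;
  input_space_linear : linear_subspace input_space ;
  input_norm_norm : norm_on input_space input_norm ;
  inputs_space : inputs `<=` input_space ;
  inputs_values : forall u, inputs u -> forall s, input_values (u s) ;
  inputs0 : inputs 0 ;
  inputs_shift : forall u tau, inputs u ->
    inputs (input_shift tau u) /\ input_norm (input_shift tau u) <= input_norm u ;
  inputs_concat : forall u v (t : {nonneg R}), inputs u -> inputs v ->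
    0 < t%:num -> inputs (input_concat t u v) ;
  flow0 : forall x u, inputs u -> flow 0%:nng x u = x ;
  flow_causal : forall (t : {nonneg R}) x u v, inputs u -> inputs v ->
    (forall s : {nonneg R}, s%:num <= t%:num -> u s = v s) ->
    flow t x u = flow t x v ;
  (* [`|t|%:nng] is [t] seen as an element of [{nonneg R}] *)
  flow_continuous : forall x u, inputs u ->
    {within `[0, +oo[, continuous (fun t : R => flow (`|t|)%:nng x u)} ;
  flow_cocycle : forall (t h : {nonneg R}) x u, inputs u ->
    flow h (flow t x u) (input_shift t u) = flow (t%:num + h%:num)%:nng x u
}.

Section stability.
Variables (R : realType) (X W : normedModType R) (S : control_system X W).

Local Notation phi := (flow S).
Local Notation normU := (input_norm S).

Definition input_ball (r : R) : set ({nonneg R} -> W) :=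
  [set u | inputs S u /\ normU u < r].

(** The closure of [input_ball r] in the set of inputs, for the metric
    induced by the input norm. *)
Definition input_closed_ball (r : R) : set ({nonneg R} -> W) :=
  [set u | inputs S u /\
    forall e : R, 0 < e -> exists2 v, input_ball r v & normU (u - v) < e].

Definition ISS : Prop :=
  exists beta gamma, [/\ class_KL beta, class_K gamma &
    forall x u t, inputs S u ->
      `|phi t x u| <= beta `|x| t%:num + gamma (normU u)].

Definition UAG : Prop :=
  exists2 gamma : R -> R, class_Kinf gamma \/ zero_gain gamma &
    forall e r : R, 0 < e -> 0 < r -> exists tau : R,
      forall u x (t : {nonneg R}), inputs S u -> ball (0 : X) r x ->
        tau <= t%:num -> `|phi t x u| <= e + gamma (normU u).

Definition CEP : Prop :=
  (forall t, phi t 0 0 = 0) /\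
  (forall e h : R, 0 < e -> 0 < h -> exists2 delta : R, 0 < delta &
    forall (t : {nonneg R}) x u, inputs S u ->
      t%:num <= h -> `|x| <= delta -> normU u <= delta -> `|phi t x u| <= e).

Definition BRS : Prop :=
  forall C tau : R, 0 < C -> 0 < tau ->
    has_ubound [set y : R | exists (t : {nonneg R}) x u,
      [/\ inputs S u, `|x| <= C, normU u <= C, t%:num <= tau
        & y = `|phi t x u|]].

Definition ULIM : Prop :=
  exists2 gamma : R -> R, class_K gamma \/ zero_gain gamma &
    forall e r : R, 0 < e -> 0 < r -> exists tau : R,
      forall x u, `|x| <= r -> inputs S u ->
        exists2 t : {nonneg R}, t%:num <= tau &
          `|phi t x u| <= e + gamma (normU u).

Definition ULS : Prop :=
  exists (sigma gamma : R -> R) (r : R),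
    [/\ class_Kinf sigma, class_Kinf gamma \/ zero_gain gamma, 0 < r &
      forall x u t, closed_ball (0 : X) r x -> input_closed_ball r u ->
        `|phi t x u| <= sigma `|x| + gamma (normU u)].

Definition UGS : Prop :=
  exists sigma gamma : R -> R,
    [/\ class_Kinf sigma, class_Kinf gamma \/ zero_gain gamma &
      forall x u t, inputs S u ->
        `|phi t x u| <= sigma `|x| + gamma (normU u)].

End stability.

(* Main.v *)
Require Import Defs.
From mathcomp Require Import all_boot all_order all_algebra.
From mathcomp Require Import all_classical all_reals all_analysis.
From mathcomp Require Import lra.

Set Implicit Arguments.
Unset Strict Implicit.
Unset Printing Implicit Defensive.

Import Order.TTheory GRing.Theory Num.Theory.
Import numFieldNormedType.Exports.

Local Open Scope classical_set_scope.
Local Open Scope ring_scope.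

(** Everything rests on two constructions of comparison functions from
    qualitative estimates on an arbitrary family of points.

    - [Kinf_majorant]: if numbers [y i] attached to radii [r i >= 0] are bounded
      on bounded sets of radii and small for small radii, then
      [y i <= sigma (r i)] for one continuous [sigma] of class K_infinity.
    - [KL_majorant]: if, moreover, each [y i] carries a time [t i], and [y i] is
      small for large times uniformly over bounded radii, then
      [y i <= beta (r i) (t i)] for one [beta] of class KL.  As in Sontag's lemma
      on KL functions, [beta u v = a (q u * expR (- v))]: with [q] growing fast
      enough at infinity, the family satisfies the hypotheses of the first
      construction for the radii [q (r i) * expR (- t i)].

    Indexing the first family by triples (time, state, input), with radius the
    larger of the two norms, shows that UGS follows as soon as trajectories from
    bounded data are bounded and trajectories from small data are small
    ([bounded_stable_UGS]).  Boundedness follows from ULIM and BRS: ULIM makes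
    trajectories return to a fixed ball in bounded time, again and again, and
    BRS controls them between two returns ([ULIM_BRS_bounded]).  Smallness is
    immediate from ULS; from UAG and CEP it follows by using CEP up to the
    attraction time and UAG afterwards.  As UAG implies ULIM, the
    second and the third condition both give ULIM and UGS.

    Conversely, ULIM and UGS give ISS: ULIM brings the trajectory once near the
    ball prescribed by its gain, UGS applied from that moment bounds it for all
    later times in terms of that ball, hence of the input, and the excess over
    this bound is a family to which [KL_majorant] applies.
    Finally ISS implies UAG because [beta] tends to 0 in time, and UGS because
    [beta] is largest at time 0; UGS in turn contains CEP and BRS. *)

(** * Families of points lie below class K_infinity functions *)

Section Ramp.
Variable R : realType.
Implicit Types a r s : R.

(** A continuous substitute for the indicator of [[a, +oo[]: it is 1 there and
    vanishes up to [a / 2]. *)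
Definition ramp a r : R := Num.min 1 (Num.max 0 (2 * r / a - 1)).

Lemma ramp_ge0 a r : 0 <= ramp a r.
Proof. by rewrite /ramp le_min ler01 le_max lexx. Qed.

Lemma ramp_le1 a r : ramp a r <= 1.
Proof. by rewrite /ramp ge_min lexx. Qed.

Lemma ramp_eq0 a r : 0 < a -> 2 * r <= a -> ramp a r = 0.
Proof.
move=> a0 ra; have h : 2 * r / a <= 1 by rewrite ler_pdivrMr// mul1r.
by rewrite /ramp max_l ?subr_le0// min_r.
Qed.

Lemma ramp_eq1 a r : 0 < a -> a <= r -> ramp a r = 1.
Proof.
move=> a0 ar; have h : 2 <= 2 * r / a by rewrite ler_pdivlMr// ler_pM2l.
have h1 : 1 <= 2 * r / a - 1 by lra.
by rewrite /ramp max_r ?min_l//; lra.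
Qed.

Lemma ramp_homo a : 0 < a -> {homo ramp a : r s / r <= s}.
Proof.
move=> a0 r s rs; rewrite /ramp le_min !ge_min lexx/=.
rewrite ge_max !le_max lexx/= lerB// ?orbT//.
by rewrite ler_pM2r ?invr_gt0// ler_pM2l.
Qed.

(** The modulus does not involve [a]: where the ramp is not yet 1, one has
    [r < a], so that its slope [2 / a] is below [2 / r]. *)
Lemma ramp_dist a r s : 0 < a -> 0 < r ->
  ramp a s <= ramp a r + 2 * `|s - r| / r.
Proof.
move=> a0 r0.
have d0 : 0 <= 2 * `|s - r| / r by rewrite divr_ge0// ?mulr_ge0// ltW.
have [ar|ra] := leP a r.
  by rewrite (ramp_eq1 a0 ar) (le_trans (ramp_le1 _ _))// lerDl.
have hs : 2 * s / a - 1 <= 2 * r / a - 1 + 2 * `|s - r| / r.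
  have h : 2 * (s - r) / a <= 2 * `|s - r| / r.
    apply: (@le_trans _ _ (2 * `|s - r| / a)).
      by rewrite ler_pM2r ?invr_gt0// ler_pM2l// ler_norm.
    by apply: ler_wpM2l; rewrite ?mulr_ge0// lef_pV2 ?posrE// ltW.
  by rewrite mulrBr mulrBl in h; lra.
move: d0 hs; set d := 2 * `|s - r| / r => d0 hs.
rewrite /ramp addr_minl addr_maxl le_min !ge_min lerDl d0/= ge_max !le_max.
by rewrite add0r d0 hs !orbT.
Qed.

End Ramp.

Section Majorant.
Variables (R : realType) (I : Type) (D : set I) (r y : I -> R).
Hypothesis r_ge0 : forall i, D i -> 0 <= r i.
Hypothesis y_bounded :
  forall rho, exists M, forall i, D i -> r i <= rho -> y i <= M.
Hypothesis y_small :
  forall e, 0 < e -> exists2 d, 0 < d & forall i, D i -> r i <= d -> y i <= e.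

(** Points of radius 0 are left out, since the ramp divides by the radius; their
    values are nonpositive anyway.  The value 0 keeps the set nonempty. *)
Definition ramp_values (s : R) : set R :=
  [set z | z = 0 \/
    exists2 i, D i /\ 0 < r i & z = Num.max 0 (y i) * ramp (r i) s].

Definition ramp_sup (s : R) : R := sup (ramp_values s).

(** Only the points of radius at most [2 * s] matter at [s], because the ramps
    of the other ones still vanish there. *)
Lemma ramp_values_le s b : 0 <= b ->
  (forall i, D i -> r i <= 2 * s -> y i <= b) -> ubound (ramp_values s) b.
Proof.
move=> b0 yb z [->//|[i [Di ri0] ->]].
have [h|/ltW h] := leP (r i) (2 * s); last by rewrite (ramp_eq0 ri0 h) mulr0.
apply: (@le_trans _ _ (Num.max 0 (y i))).
  by rewrite ler_piMr ?ramp_le1// le_max lexx.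
by rewrite ge_max b0 yb.
Qed.

Lemma y_bounded_ge0 rho :
  exists2 M, 0 <= M & forall i, D i -> r i <= rho -> y i <= M.
Proof.
have [M yM] := y_bounded rho; exists (Num.max 0 M); first by rewrite le_max lexx.
by move=> i Di ri; rewrite le_max yM ?orbT.
Qed.

Lemma ramp_values_sup s z : ramp_values s z -> z <= ramp_sup s.
Proof.
apply: ub_le_sup; have [b b0 yb] := y_bounded_ge0 (2 * s).
by exists b; exact: ramp_values_le.
Qed.

Lemma ramp_sup_le s b : ubound (ramp_values s) b -> ramp_sup s <= b.
Proof. by apply: ge_sup; exists 0; left. Qed.

Lemma ramp_sup_ge0 s : 0 <= ramp_sup s.
Proof. by apply: ramp_values_sup; left. Qed.

Lemma ramp_sup_homo : {homo ramp_sup : s t / s <= t}.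
Proof.
move=> s t st; apply: ramp_sup_le => z [->|[i [Di ri0] ->]].
  exact: ramp_sup_ge0.
apply: le_trans (ramp_values_sup
  (or_intror (ex_intro2 _ _ i (conj Di ri0) erefl))).
by rewrite ler_wpM2l ?ramp_homo// le_max lexx.
Qed.

Lemma ramp_sup_dist b s t : 0 <= b ->
  (forall i, D i -> r i <= 2 * t -> y i <= b) -> 0 < s ->
  ramp_sup t <= ramp_sup s + b * (2 * `|t - s| / s).
Proof.
move=> b0 yb s0.
have d0 : 0 <= 2 * `|t - s| / s by rewrite divr_ge0// ?mulr_ge0// ltW.
apply: ramp_sup_le => z [->|[i [Di ri0] ->]].
  by rewrite addr_ge0 ?ramp_sup_ge0 ?(mulr_ge0 b0 d0).
have [h|/ltW h] := leP (r i) (2 * t); last first.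
  by rewrite (ramp_eq0 ri0 h) mulr0 addr_ge0 ?ramp_sup_ge0 ?(mulr_ge0 b0 d0).
have y0 : 0 <= Num.max 0 (y i) by rewrite le_max lexx.
apply: (@le_trans _ _ (Num.max 0 (y i) * (ramp (r i) s + 2 * `|t - s| / s))).
  by rewrite ler_wpM2l// ramp_dist.
rewrite mulrDr lerD//.
  by apply: ramp_values_sup; right; exists i.
by rewrite ler_wpM2r// ge_max b0 yb.
Qed.

(** Away from 0 the functions under the supremum are equi-Lipschitz; at 0 (and
    at negative arguments) the supremum is squeezed by the smallness of [y]. *)
Lemma ramp_sup_continuous : continuous ramp_sup.
Proof.
move=> s; apply/cvgrPdist_le => e e0; have [s0|s0] := leP s 0.
  have [d d0 yd] := y_small e0.
  have sd : 0 < d / 2 by rewrite divr_gt0.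
  have near_le t : t < d / 2 -> ramp_sup t <= e.
    move=> td; apply/ramp_sup_le/ramp_values_le; first exact: ltW.
    by move=> i Di it; apply: yd => //; apply: le_trans it _; lra.
  near=> t; rewrite ler_norml.
  have := near_le s (le_lt_trans s0 sd); have := ramp_sup_ge0 s.
  suff : ramp_sup t <= e by have := ramp_sup_ge0 t; lra.
  by apply: near_le; near: t; apply: lt_nbhsl => //; exact: le_lt_trans s0 sd.
have [b b0 yb] := y_bounded_ge0 (4 * s).
have c0 : 0 < 4 * b + 1 by lra.
near=> t.
have ts2 : `|s - t| < s / 2.
  by near: t; apply: (@cvgr_dist_lt _ R^o _ (nbhs s) _ id s) => //; rewrite divr_gt0.
have tse : `|s - t| < e * s / (4 * b + 1).
  near: t; apply: (@cvgr_dist_lt _ R^o _ (nbhs s) _ id s) => //.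
  by rewrite divr_gt0// mulr_gt0.
(* the modulus at [u], [2 * b / u], is at most [4 * b / s]; adding 1 to [4 * b]
   above avoids a division by 0 *)
have small u : s / 2 <= u -> b * (2 * `|s - t| / u) <= e.
  move=> su; have u0 : 0 < u by lra.
  rewrite mulrA ler_pdivrMr//.
  move: tse; rewrite ltr_pdivlMr// => tse.
  have : e * s <= e * (2 * u) by rewrite ler_pM2l//; lra.
  by have := normr_ge0 (s - t); nra.
have [st1 st2] : s / 2 < t /\ t < 2 * s.
  by move: ts2; rewrite ltr_norml => /andP[]; lra.
have h1 : ramp_sup t <= ramp_sup s + e.
  apply: le_trans (ramp_sup_dist (s := s) b0 _ s0) _.
    by move=> i Di it; apply: yb => //; apply: le_trans it _; lra.
  by rewrite lerD2l distrC small//; lra.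
have h2 : ramp_sup s <= ramp_sup t + e.
  apply: le_trans (ramp_sup_dist (s := t) b0 _ _) _; last 2 first.
  - by lra.
  - by rewrite lerD2l small//; lra.
  - by move=> i Di it; apply: yb => //; apply: le_trans it _; lra.
by rewrite ler_norml; lra.
Unshelve. all: by end_near. Qed.

(** The identity is added to the supremum of ramps to make it strictly
    increasing and unbounded. *)
Lemma Kinf_majorant :
  exists sigma, [/\ class_Kinf sigma, continuous sigma &
    forall i, D i -> y i <= sigma (r i)].
Proof.
pose sigma s := ramp_sup s + s; exists sigma.
have cs : continuous sigma.
  by move=> s; apply: cvgD; [exact: ramp_sup_continuous|exact: cvg_id].
have r0 : ramp_sup 0 = 0.
  apply/eqP; rewrite eq_le ramp_sup_ge0 andbT; apply/ler_addgt0Pl => e e0.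
  rewrite addr0; apply/ramp_sup_le/ramp_values_le; first exact: ltW.
  have [d d0 yd] := y_small e0.
  by move=> i Di it; apply: yd => //; rewrite mulr0 in it; apply: le_trans it (ltW d0).
split=> //.
- split.
    split.
    + exact: continuous_subspaceT.
    + by move=> s s0; rewrite addr_ge0 ?ramp_sup_ge0.
    + by move=> s t _ st; rewrite ler_ltD// ramp_sup_homo// ltW.
    + by rewrite /sigma r0 addr0.
  move=> M; exists (`|M| + 1); first by rewrite addr_ge0.
  by have := ler_norm M; have := ramp_sup_ge0 (`|M| + 1); rewrite /sigma; lra.
- move=> i Di; have := r_ge0 Di; rewrite le_eqVlt => /predU1P[ri0|ri0].
    rewrite -ri0 /sigma r0 addr0; apply/ler_addgt0Pl => e e0; rewrite addr0.
    by have [d d0 yd] := y_small e0; apply: yd => //; rewrite -ri0 ltW.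
  apply: (@le_trans _ _ (ramp_sup (r i))); last by rewrite lerDl ltW.
  apply: (@le_trans _ _ (Num.max 0 (y i) * ramp (r i) (r i))).
    by rewrite ramp_eq1// mulr1 le_max lexx orbT.
  by apply: ramp_values_sup; right; exists i.
Qed.

End Majorant.

(** * Gains *)

Section Gains.
Variable R : realType.
Implicit Types (g : R -> R) (r s e : R).

(** A common setting for the gains of UAG, ULIM, ULS, UGS and ISS. *)
Definition gain g := class_K g \/ zero_gain g.

Lemma Kinf_gain g : class_Kinf g \/ zero_gain g -> gain g.
Proof. by case=> [[]|]; [left|right]. Qed.

Lemma gain_homo g r s : gain g -> 0 <= r -> r <= s -> g r <= g s.
Proof.
case=> [[_ _ gh _]|g0] r0; rewrite le_eqVlt => /predU1P[->//|rs].
  by rewrite ltW// gh.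
by rewrite !g0// (le_trans r0)// ltW.
Qed.

Lemma gain_ge0 g r : gain g -> 0 <= r -> 0 <= g r.
Proof. by case=> [[_ g_ge0 _ _]|g0] r0; [exact: g_ge0|rewrite g0]. Qed.

Lemma gain0 g : gain g -> g 0 = 0.
Proof. by case=> [[]//|->]. Qed.

Lemma gain_small g e : gain g -> 0 < e ->
  exists2 d, 0 < d & forall r, 0 <= r -> r <= d -> g r <= e.
Proof.
case=> [[gc g_ge0 _ g00]|g0] e0; last first.
  by exists 1 => // r r0 _; rewrite (g0 r r0) ltW.
have /subspace_continuousP/(_ 0) := gc; rewrite /= in_itv/= lexx => /(_ isT).
move=> /cvgrPdist_le/(_ e e0); rewrite near_withinE => -[d /= d0 gd].
exists (d / 2); first by rewrite divr_gt0.
move=> r r0 rd; apply: le_trans (ler_norm _) _.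
rewrite -normrN -(sub0r (g r)) -{1}g00; apply: gd; last by rewrite /= in_itv/= r0.
by rewrite /= sub0r normrN ger0_norm//; lra.
Qed.

End Gains.

(** * Families vanishing at infinity are bounded by class KL functions *)

(** This separable form makes joint continuity a matter of composition. *)
Lemma KL_separable (R : realType) (a b : R -> R) : class_K a -> continuous a ->
  class_K b -> continuous b -> class_KL (fun u v => a (b u * expR (- v))).
Proof.
move=> aK ca bK cb.
have [_ a0 amono a00] := aK; have [_ b0 bmono b00] := bK.
have c2 : continuous (fun p : R * R => a (b p.1 * expR (- p.2))).
  move=> p; apply: (@continuous_comp _ _ _
    (fun p : R * R => b p.1 * expR (- p.2)) a).
    apply: cvgM.
      apply: (@continuous_comp _ _ _ fst b); [exact: cvg_fst|exact: cb].
    apply: (@continuous_comp _ _ _ (fun p : R * R => - p.2) expR).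
      by apply: cvgN; exact: cvg_snd.
    exact: continuous_expR.
  exact: ca.
split.
- exact: continuous_subspaceT.
- move=> v v0; split.
  + apply: continuous_subspaceT => u.
    apply: (@continuous_comp _ _ _ (fun u => b u * expR (- v)) a); last exact: ca.
    by apply: cvgM; [exact: cb|exact: cvg_cst].
  + by move=> u u0; rewrite a0// mulr_ge0 ?b0 ?expR_ge0.
  + move=> u w u0 uw; rewrite amono ?mulr_ge0 ?b0 ?expR_ge0//.
    by rewrite ltr_pM2r ?expR_gt0// bmono.
  + by rewrite b00 mul0r.
- move=> u u0; have bu : 0 < b u by rewrite -b00 bmono.
  split.
  + apply: continuous_subspaceT => v.
    apply: (@continuous_comp _ _ _ (fun v => b u * expR (- v)) a); last exact: ca.
    apply: cvgM; first exact: cvg_cst.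
    apply: (@continuous_comp _ _ _ (fun v : R => - v) expR).
      by apply: cvgN; exact: cvg_id.
    exact: continuous_expR.
  + by move=> v v0; rewrite a0// mulr_ge0 ?expR_ge0 ?ltW.
  + move=> v w v0 vw; rewrite amono ?mulr_ge0 ?expR_ge0 ?(ltW bu)//.
    by rewrite ltr_pM2l// ltr_expR ltrN2.
  + have lim0 : b u * expR (- v) @[v --> +oo] --> (0 : R).
      by rewrite -(mulr0 (b u)); apply: cvgM; [exact: cvg_cst|exact: cvgr_expR].
    by rewrite -a00; apply: continuous_cvg lim0; exact: ca.
Qed.

Section KLMajorant.
Variables (R : realType) (I : Type) (D : set I) (r t y : I -> R) (s : R -> R).
Hypothesis r_ge0 : forall i, D i -> 0 <= r i.
Hypothesis s_gain : gain s.
Hypothesis y_le : forall i, D i -> y i <= s (r i).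
Hypothesis y_attracted : forall e rho, 0 < e -> 0 < rho ->
  exists T, forall i, D i -> r i <= rho -> T <= t i -> y i <= e.

(** Let [T n] be a time after which [y] is below [1 / (n + 1)] on radii up to
    [n + 1], and let [q] be of class K_infinity with
    [q n >= (n + 1) * expR (T n)] for [n > 0].  If
    [q (r i) * expR (- t i) <= u <= r i] with [0 < u] and [1 <= r i], and [n] is
    the integer part of [r i], then [t i >= T n].  Hence large radii contribute
    at most [1 / (n + 1)], and bounded radii are controlled by [s] near 0 and by
    a single [T N] elsewhere. *)
Lemma KL_majorant :
  exists2 beta, class_KL beta &
    forall i, D i -> 0 <= t i -> y i <= beta (r i) (t i).
Proof.
have /choice[T yT] : forall n : nat, exists T, forall i, D i ->
    r i <= n.+1%:R -> T <= t i -> y i <= n.+1%:R^-1.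
  by move=> n; apply: y_attracted; rewrite ?invr_gt0.
have [|||q [[qK _] cq qT]] := @Kinf_majorant R nat [set n | (0 < n)%N]
    (fun n => n%:R) (fun n => n.+1%:R * expR (T n)).
- by move=> n _.
- move=> rho; exists (\sum_(k < (Num.trunc rho).+1) k.+1%:R * expR (T k)).
  move=> n _ nr; have nt : (n < (Num.trunc rho).+1)%N.
    by rewrite ltnS truncn_ge_nat// (le_trans _ nr).
  rewrite (bigD1 (Ordinal nt))//= lerDl; apply: sumr_ge0 => k _.
  by rewrite mulr_ge0 ?expR_ge0.
- (* no positive integer is below 1/2, so smallness near 0 is vacuous *)
  move=> e e0; exists 2^-1 => // n /= n0.
  have : 1 <= n%:R :> R by rewrite ler1n.
  by lra.
have qg : gain q by left.
have q_gt0 u : 0 < u -> 0 < q u.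
  by have [_ _ qmono q0] := qK; rewrite -[in X in _ -> X]q0; exact: qmono.
have yn i n u : D i -> 0 < u -> u <= r i -> 1 <= r i -> Num.trunc (r i) = n ->
    q (r i) * expR (- t i) <= u -> y i <= n.+1%:R^-1.
  move=> Di u0 ur r1 rn qu.
  have r0 := r_ge0 Di.
  have := truncn_itv r0; rewrite rn => /andP[nr rn1].
  apply: yT => //; first exact: ltW.
  have n0 : (0 < n)%N by rewrite -rn truncn_gt0.
  rewrite -ler_expR -(@ler_pM2l _ n.+1%:R)//.
  apply: (le_trans (qT n n0)); apply: (le_trans (gain_homo qg (ler0n _ n) nr)).
  rewrite expRN ler_pdivrMr ?expR_gt0// in qu.
  apply: (le_trans qu); rewrite ler_pM2r ?expR_gt0//.
  exact: le_trans ur (ltW rn1).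
have [||| a [[aK _] ca ya]] := @Kinf_majorant R I [set i | D i /\ 0 <= t i]
    (fun i => q (r i) * expR (- t i)) y.
- by move=> i [Di ti]; rewrite mulr_ge0 ?expR_ge0// gain_ge0// r_ge0.
- move=> rho; pose u := Num.max 1 rho.
  have u1 : 1 <= u by rewrite le_max lexx.
  have u0 : 0 < u by exact: lt_le_trans u1.
  exists (s u + 1) => i [Di ti] qr.
  have qu : q (r i) * expR (- t i) <= u by rewrite (le_trans qr)// le_max lexx orbT.
  have [ru|ur] := leP (r i) u.
    apply: (le_trans (y_le Di)).
    apply: (le_trans (gain_homo s_gain (r_ge0 Di) ru)).
    by rewrite lerDl.
  apply: (le_trans (yn i _ u Di u0 (ltW ur) (ltW (le_lt_trans u1 ur)) erefl qu)).
  apply: (@le_trans _ _ 1); first by rewrite invf_le1// ler1n.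
  by rewrite lerDr gain_ge0// ltW.
- move=> e e0; have [d d0 sd] := gain_small s_gain e0.
  (* beyond radius [N + 1] the bound [1 / (n + 1)] is already below [e] *)
  pose N := Num.trunc e^-1.
  have Ne n : (N <= n)%N -> n.+1%:R^-1 <= e.
    move=> Nn; rewrite -[leRHS]invrK lef_pV2 ?posrE ?invr_gt0//.
    by rewrite (le_trans (ltW (truncnS_gt _)))// ler_nat.
  exists (Num.min 1 (Num.min d (q d * expR (- T N)))).
    by rewrite !lt_min ltr01 d0 mulr_gt0 ?expR_gt0 ?q_gt0.
  move=> i [Di ti]; rewrite !le_min => /and3P[q1 qd qN].
  have [rd|/ltW dr] := leP (r i) d.
    by apply: le_trans (y_le Di) (sd _ (r_ge0 Di) rd).
  have [rN|Nr] := leP (r i) N.+1%:R.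
    apply: le_trans (Ne N (leqnn N)); apply: yT => //.
    have : q d * expR (- t i) <= q d * expR (- T N).
      apply: le_trans qN; rewrite ler_pM2r ?expR_gt0//.
      exact: gain_homo qg (ltW d0) dr.
    by rewrite ler_pM2l ?q_gt0// ler_expR lerN2.
  have r1 : 1 <= r i by rewrite (le_trans _ (ltW Nr))// ler1n.
  apply: le_trans (yn i _ 1 Di ltr01 r1 r1 erefl q1) (Ne _ _).
  by rewrite truncn_ge_nat ?r_ge0// (le_trans _ (ltW Nr))// ler_nat.
exists (fun u v => a (q u * expR (- v))); first exact: KL_separable.
by move=> i Di ti; apply: ya.
Qed.

End KLMajorant.

(** * Stability of control systems *)

Section Systems.
Variables (R : realType) (X W : normedModType R) (S : control_system X W).
Local Notation phi := (flow S).
Local Notation normU := (input_norm S).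

Lemma normU_ge0 u : inputs S u -> 0 <= normU u.
Proof. by have [N_ge0 _ _ _] := input_norm_norm S => /inputs_space/N_ge0. Qed.

Lemma normU0 : normU 0 = 0.
Proof.
have [_ _ h _] := input_norm_norm S.
by rewrite -(scale0r 0) h ?normr0 ?mul0r//; exact/inputs_space/inputs0.
Qed.

Lemma input_closed_ball_lt u r :
  inputs S u -> normU u < r -> input_closed_ball S r u.
Proof. by move=> Su ur; split=> // e e0; exists u; rewrite // subrr normU0. Qed.

Lemma flow_split (s t : {nonneg R}) x u : inputs S u -> s%:num <= t%:num ->
  phi t x u = phi (`|t%:num - s%:num|)%:nng (phi s x u) (input_shift s u).
Proof.
move=> Su st; rewrite flow_cocycle//; congr (phi _ x u); apply: val_inj => /=.
by rewrite ger0_norm ?subr_ge0// subrKC.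
Qed.

Definition bounded_flow := forall C, exists M, forall t x u, inputs S u ->
  `|x| <= C -> normU u <= C -> `|phi t x u| <= M.

Definition stable_flow := forall e, 0 < e -> exists2 d, 0 < d &
  forall t x u, inputs S u -> `|x| <= d -> normU u <= d -> `|phi t x u| <= e.

(** [Kinf_majorant] bounds the flow by [sigma] of the larger norm, hence by the
    sum of [sigma] at both norms: one function serves as bound and as gain. *)
Lemma bounded_stable_UGS : bounded_flow -> stable_flow -> UGS S.
Proof.
move=> bnd stab.
have [|||sigma [sK _ sle]] :=
    @Kinf_majorant R ({nonneg R} * X * ({nonneg R} -> W))
    [set p | inputs S p.2] (fun p => Num.max `|p.1.2| (normU p.2))
    (fun p => `|phi p.1.1 p.1.2 p.2|).
- by move=> p _; rewrite le_max normr_ge0.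
- move=> C; have [M h] := bnd C; exists M => -[[t x] u]/= Su.
  by rewrite ge_max => /andP[]; exact: h.
- move=> e /stab[d d0 h]; exists d => // -[[t x] u]/= Su.
  by rewrite ge_max => /andP[]; exact: h.
exists sigma, sigma; split=> //; first by left.
move=> x u t Su; apply: (le_trans (sle (t, x, u) Su)) => /=.
have sg : gain sigma by left; case: sK.
have [_|_] := leP `|x| (normU u); first by rewrite lerDr gain_ge0.
by rewrite lerDl gain_ge0// normU_ge0.
Qed.

Lemma UGS_BRS : UGS S -> BRS S.
Proof.
move=> [sigma [gamma [[sK _] /Kinf_gain gg h]]] C tau C0 tau0.
exists (sigma C + gamma C) => _ [t [x [u [Su xC uC _ ->]]]].
apply: le_trans (h x u t Su) _; rewrite lerD// gain_homo ?normU_ge0//.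
by left.
Qed.

Lemma UGS_ULS : UGS S -> ULS S.
Proof.
move=> [sigma [gamma [sK gg h]]]; exists sigma, gamma, 1; split=> //.
by move=> x u t _ [Su _]; exact: h.
Qed.

Lemma ULS_stable : ULS S -> stable_flow.
Proof.
move=> [sigma [gamma [r [[sK _] /Kinf_gain gg r0 h]]]] e e0.
have e20 : 0 < e / 2 by rewrite divr_gt0.
have [d1 d10 h1] := gain_small (or_introl sK : gain sigma) e20.
have [d2 d20 h2] := gain_small gg e20.
exists (Num.min (r / 2) (Num.min d1 d2));
  first by rewrite !lt_min divr_gt0 ?d10.
move=> t x u Su; rewrite !le_min => /and3P[xr xd1 _] /and3P[ur _ ud2].
have := h1 _ (normr_ge0 x) xd1; have := h2 _ (normU_ge0 Su) ud2.
suff : `|phi t x u| <= sigma `|x| + gamma (normU u) by lra.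
apply: h; last by apply: input_closed_ball_lt => //; lra.
by apply: subset_closed_ball; rewrite -ball_normE /ball_/= sub0r normrN; lra.
Qed.

Lemma BRSP C tau : BRS S -> exists M, forall t x u, inputs S u ->
  t%:num <= tau -> `|x| <= C -> normU u <= C -> `|phi t x u| <= M.
Proof.
move=> brs; have [||M ubM] := brs (`|C| + 1) (`|tau| + 1); rewrite ?ltr_wpDl//.
exists M => t x u Su tt xC uC; apply: ubM; exists t, x, u.
have := ler_norm C; have := ler_norm tau; split=> //; lra.
Qed.

(** ULIM alone may return the time 0, so the trajectory is first let go for one
    unit of time, which BRS allows; the next visit to the ball of radius [K]
    then happens between the times 1 and [tau + 1].  Induction on an
    integer bound of the time, restarting at each visit, concludes. *)
Lemma ULIM_BRS_bounded : ULIM S -> BRS S -> bounded_flow.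
Proof.
move=> [gamma gg lim] brs C0; pose C := `|C0|.
pose K := Num.max C (1 + gamma C).
have CK : C <= K by rewrite le_max lexx.
have [M1 hM1] := BRSP K 1 brs.
have M1_gt0 : 0 < `|M1| + 1 by rewrite ltr_wpDl.
have [tau htau] := lim 1 (`|M1| + 1) ltr01 M1_gt0.
have [M hM] := BRSP K (tau + 1) brs.
have return_time x u : inputs S u -> `|x| <= K -> normU u <= C ->
    exists s : {nonneg R},
      [/\ 1 <= s%:num, s%:num <= tau + 1 & `|phi s x u| <= K].
  move=> Su xK uC.
  pose one := NngNum (@ler01 R).
  have [Su1 uu1] := inputs_shift one Su.
  have [|s st] := htau (phi one x u) (input_shift one u) _ Su1.
    apply: (@le_trans _ _ M1); last by rewrite (le_trans (ler_norm _))// lerDl.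
    by apply: hM1 => //; exact: le_trans CK.
  rewrite flow_cocycle// => hs; exists (one%:num + s%:num)%:nng; split=> /=.
  - by rewrite lerDl.
  - by rewrite addrC lerD2r.
  - apply: le_trans hs _; rewrite /K le_max; apply/orP; right.
    by rewrite lerD2l gain_homo ?normU_ge0// (le_trans uu1).
suff main n : forall t x u, inputs S u -> `|x| <= K -> normU u <= C ->
    t%:num <= n%:R -> `|phi t x u| <= M.
  exists M => t x u Su xC uC; apply: (main (Num.trunc t%:num).+1) => //.
  - by rewrite (le_trans xC)// (le_trans (ler_norm _)).
  - by rewrite (le_trans uC)// ler_norm.
  - exact/ltW/truncnS_gt.
elim: n => [|n IHn] t x u Su xK uC tn.
  have [s [s1 st _]] := return_time x u Su xK uC.
  by apply: hM => //; [lra|exact: le_trans CK].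
have [s [s1 st sK]] := return_time x u Su xK uC.
have [ts|st'] := leP t%:num s%:num.
  by apply: hM => //; [exact: le_trans st|exact: le_trans CK].
have [Ss us] := inputs_shift s Su.
rewrite (flow_split x Su (ltW st')); apply: IHn => //; first exact: le_trans uC.
rewrite /= ger0_norm ?subr_ge0 ?(ltW st')//; rewrite -natr1 in tn; lra.
Qed.

Lemma UAG_CEP_stable : UAG S -> CEP S -> stable_flow.
Proof.
move=> [gamma /Kinf_gain gg att] [_ cep] e e0.
have e20 : 0 < e / 2 by rewrite divr_gt0.
have [tau htau] := att (e / 2) 1 e20 ltr01.
have [d1 d10 h1] := gain_small gg e20.
have tau0 : 0 < `|tau| + 1 by rewrite ltr_wpDl.
have [d2 d20 h2] := cep e (`|tau| + 1) e0 tau0.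
exists (Num.min (1 / 2) (Num.min d1 d2)); first by rewrite !lt_min divr_gt0 ?d10.
move=> t x u Su; rewrite !le_min => /and3P[x1 _ xd2] /and3P[_ ud1 ud2].
have [tt|tt] := leP t%:num (`|tau| + 1); first exact: h2.
have := h1 _ (normU_ge0 Su) ud1.
suff : `|phi t x u| <= e / 2 + gamma (normU u) by lra.
apply: htau => //; last by have := ler_norm tau; lra.
by rewrite -ball_normE /ball_/= sub0r normrN; lra.
Qed.

Lemma UAG_ULIM : UAG S -> ULIM S.
Proof.
move=> [gamma /Kinf_gain gg att]; exists gamma => // e r e0 r0.
have r10 : 0 < r + 1 by lra.
have [tau htau] := att e (r + 1) e0 r10.
exists `|tau| => x u xr Su; exists (`|tau|)%:nng => //.
apply: htau => //=; last exact: ler_norm.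
by rewrite -ball_normE /ball_/= sub0r normrN; lra.
Qed.

(** The gain of ISS is only of class K, so it is first replaced by a class
    K_infinity majorant. *)
Lemma ISS_UAG : ISS S -> UAG S.
Proof.
move=> [beta [gamma [[_ bK bL] gK h]]].
have gg : gain gamma by left.
have [|||g [gKinf _ gle]] := @Kinf_majorant R R [set r | 0 <= r] id gamma.
- by [].
- by move=> C; exists (gamma C) => r r0; exact: gain_homo.
- move=> e /(gain_small gg)[d d0 hd]; exists d => //.
exists g; first by left.
move=> e r e0 r0; have [_ _ bdec /cvgrPdist_le/(_ e e0)] := bL r r0.
move=> [T [_ hT]]; exists (`|T| + 1) => u x t Su.
rewrite -ball_normE /ball_/= sub0r normrN => xr tT.
apply: le_trans (h x u t Su) _; rewrite lerD ?gle//; last exact: normU_ge0.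
have bg : gain (beta ^~ t%:num) by left; exact: bK.
apply: (@le_trans _ _ (beta r t%:num)).
  exact: (gain_homo bg (normr_ge0 x) (ltW xr)).
have := hT t%:num; rewrite sub0r normrN => hTt.
by apply: le_trans (ler_norm _) (hTt _); have := ler_norm T; lra.
Qed.

Lemma ISS_UGS : ISS S -> UGS S.
Proof.
move=> [beta [gamma [[_ bK bL] gK h]]].
have gg : gain gamma by left.
have b0K : gain (beta ^~ 0) by left; exact: bK.
have le0 x u t : inputs S u -> `|phi t x u| <= beta `|x| 0 + gamma (normU u).
  move=> Su; apply: le_trans (h x u t Su) _; rewrite lerD2r.
  have [x0|x0] := eqVneq x 0.
    rewrite x0 normr0 (gain0 b0K).
    by rewrite (gain0 (or_introl (bK _ (ge0 t)) : gain _)).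
  rewrite -normr_gt0 in x0; have [_ _ bdec _] := bL _ x0.
  have [->//|t0] := eqVneq t%:num 0.
  by apply/ltW/bdec; rewrite // lt_neqAle eq_sym t0/=.
apply: bounded_stable_UGS => [C|e e0].
  exists (beta C 0 + gamma C) => t x u Su xC uC.
  apply: le_trans (le0 x u t Su) _; apply: lerD.
    exact: (gain_homo b0K).
  by rewrite gain_homo ?normU_ge0.
have e20 : 0 < e / 2 by rewrite divr_gt0.
have [d1 d10 h1] := gain_small b0K e20.
have [d2 d20 h2] := gain_small gg e20.
exists (Num.min d1 d2); first by rewrite lt_min d10.
move=> t x u Su; rewrite !le_min => /andP[xd1 _] /andP[_ ud2].
have := h1 _ (normr_ge0 x) xd1; have := h2 _ (normU_ge0 Su) ud2.
by have := le0 x u t Su; lra.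
Qed.

Lemma UGS_CEP : UGS S -> CEP S.
Proof.
move=> ugs; have stab := ULS_stable (UGS_ULS ugs).
split.
  move=> t; apply/eqP; rewrite -normr_le0; apply/ler_addgt0Pl => e e0.
  rewrite addr0; have [d d0 hd] := stab e e0.
  by apply: hd; rewrite ?normr0 ?normU0 ?ltW//; exact: inputs0.
by move=> e h /stab[d d0 hd] _; exists d => // t x u Su _; exact: hd.
Qed.

(** If [`|phi s x u| <= d / 2 + g1 (normU u)] at one time [s], then afterwards
    UGS bounds the flow by [sigma d + sigma (2 * g1 (normU u)) + g2 (normU u)].  The
    last two terms depend on the input only; a class K majorant of their sum is
    the gain of ISS. *)
Lemma ULIM_UGS_ISS : ULIM S -> UGS S -> ISS S.
Proof.
move=> [g1 g1g lim] [sigma [g2 [[sK _] /Kinf_gain g2g ugs]]].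
have sg : gain sigma by left.
have [|||g [[gK _] _ gle]] := @Kinf_majorant R R [set r | 0 <= r] id
    (fun r => sigma (2 * g1 r) + g2 r).
- by [].
- move=> C; exists (sigma (2 * g1 C) + g2 C) => r /= r0 rC.
  apply: lerD; last exact: gain_homo.
  apply: gain_homo => //; first by apply: mulr_ge0 => //; exact: gain_ge0.
  by rewrite ler_pM2l// gain_homo.
- move=> e e0; have e20 : 0 < e / 2 by rewrite divr_gt0.
  have [d0 d00 h0] := gain_small sg e20.
  have d020 : 0 < d0 / 2 by rewrite divr_gt0.
  have [d1 d10 h1] := gain_small g1g d020.
  have [d2 d20 h2] := gain_small g2g e20.
  exists (Num.min d1 d2); first by rewrite lt_min d10.
  move=> r /= r0; rewrite le_min => /andP[rd1 rd2].
  have := h2 r r0 rd2; have := h1 r r0 rd1; have := gain_ge0 g1g r0 => g1r0 g1r.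
  by have := h0 (2 * g1 r); rewrite mulr_ge0//; lra.
have sigmaD a b : 0 <= a -> 0 <= b ->
    sigma (a + b) <= sigma (2 * a) + sigma (2 * b).
  move=> a0 b0; have [ab|/ltW ba] := leP a b.
    apply: (@le_trans _ _ (sigma (2 * b))); last first.
      by rewrite lerDr; apply: gain_ge0 => //; exact: mulr_ge0.
    by rewrite gain_homo ?addr_ge0//; lra.
  apply: (@le_trans _ _ (sigma (2 * a))); last first.
      by rewrite lerDl; apply: gain_ge0 => //; exact: mulr_ge0.
  by rewrite gain_homo ?addr_ge0//; lra.
have [||||beta bKL hb] := @KL_majorant R ({nonneg R} * X * ({nonneg R} -> W))
    [set p | inputs S p.2] (fun p => `|p.1.2|) (fun p => p.1.1%:num)
    (fun p => `|phi p.1.1 p.1.2 p.2| - g (normU p.2)) sigma.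
- by [].
- exact: sg.
- move=> [[t x] u]/= Su; have := gle _ (normU_ge0 Su); have := ugs x u t Su.
  have := gain_ge0 sg (mulr_ge0 (ler0n R 2) (gain_ge0 g1g (normU_ge0 Su))).
  by rewrite /=; lra.
- move=> e rho e0 rho0.
  have [d d0 hd] := gain_small sg e0.
  have d20 : 0 < d / 2 by rewrite divr_gt0.
  have [tau htau] := lim (d / 2) rho d20 rho0.
  exists tau => -[[t x] u]/= Su xr tt.
  have [s st hs] := htau x u xr Su.
  have [Ss us] := inputs_shift s Su.
  rewrite (flow_split x Su (le_trans st tt)) lerBlDr.
  have u0 := normU_ge0 Su.
  apply: le_trans (ugs _ _ _ Ss) _.
  have := gain_homo g2g (normU_ge0 Ss) us.
  have := gain_homo sg (normr_ge0 _) hs.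
  have := sigmaD (d / 2) (g1 (normU u)) (ltW d20) (gain_ge0 g1g u0).
  have := gle _ u0 => /=.
  have := hd d (ltW d0) (lexx d).
  have -> : 2 * (d / 2) = d by lra.
  by lra.
exists beta, g; split=> // x u t Su.
by rewrite -lerBlDr; exact: (hb (t, x, u) Su (ge0 t)).
Qed.

End Systems.

Theorem theorem5 (R : realType) (X W : normedModType R)
    (S : control_system X W) :
  [<-> ISS S;
       UAG S /\ CEP S /\ BRS S;
       ULIM S /\ ULS S /\ BRS S;
       ULIM S /\ UGS S].
Proof.
tfae.
- move=> iss; have ugs := ISS_UGS iss.
  by split; [exact: ISS_UAG|split; [exact: UGS_CEP|exact: UGS_BRS]].
- move=> [uag [cep brs]]; have ulim := UAG_ULIM uag.
  split=> //; split=> //; apply/UGS_ULS/bounded_stable_UGS.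
    exact: ULIM_BRS_bounded.
  exact: UAG_CEP_stable.
- move=> [ulim [uls brs]]; split=> //; apply: bounded_stable_UGS.
    exact: ULIM_BRS_bounded.
  exact: ULS_stable.
- by case; exact: ULIM_UGS_ISS.
Qed.
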